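(* For every $v\equiv 1$ or $3 \pmod 6$ with $v\neq 7$ (and $v>3$), there exists a $3$-way $\frac{v-1}{2}$-homogeneous $(v,3,2)$ Steiner trade of volume $v(v-1)/6$.
   Context: Let $V$ be a finite set with $v$ elements and let $t<k<v$ be positive integers (standing assumption in the definition of trades). A $\mu$-way $(v,k,t)$ trade $T=\{T_1,\dots,T_\mu\}$ of volume $m$ consists of $\mu$ pairwise disjoint collections $T_1,\dots,T_\mu$, each of $m$ blocks ($k$-subsets of $V$), such that every $t$-subset of $V$ is contained in the same number of blocks in each $T_i$. The foundation $\mathrm{found}(T)$ is the set of elements covered by the blocks. It is a Steiner trade if every $t$-subset of $\mathrm{found}(T)$ is in at most one block of each $T_i$, and $d$-homogeneous if every element of $V$ lies in exactly $d$ blocks of each $T_i$. *)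

(* Defs.v *)
From mathcomp Require Import all_boot.
Set Implicit Arguments.
Unset Strict Implicit.
Unset Printing Implicit Defensive.

Section Trades.

Variables (V : finType) (mu : nat).

(* The collections are indexed by 'I_mu and are sets (not multisets) of       *)
(* blocks; in a Steiner trade a repeated block is impossible in any case,     *)
(* since its t-subsets would lie in two blocks.                               *)
Implicit Type T : 'I_mu -> {set {set V}}.

Definition blocks_through (B : {set {set V}}) (S : {set V}) : {set {set V}} :=
  [set b in B | S \subset b].

(* The (v, k, t) of the literature has v = #|V|. *)
Record is_trade (k t m : nat) T : Prop := IsTrade {
  trade_params : [/\ 0 < t, t < k & k < #|V|];
  trade_disjoint : forall i j : 'I_mu, i != j -> [disjoint T i & T j];
  trade_volume : forall i : 'I_mu, #|T i| = m;
  trade_block_size : forall (i : 'I_mu) (b : {set V}), b \in T i -> #|b| = k;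
  trade_balanced : forall (S : {set V}), #|S| = t ->
    forall i j : 'I_mu, #|blocks_through (T i) S| = #|blocks_through (T j) S|
}.

Definition found T : {set V} := \bigcup_(i < mu) cover (T i).

Definition is_steiner_trade (k t m : nat) T : Prop :=
  is_trade k t m T /\
  forall S : {set V}, S \subset found T -> #|S| = t ->
    forall i : 'I_mu, #|blocks_through (T i) S| <= 1.

Definition homogeneous (d : nat) T : Prop :=
  forall (x : V) (i : 'I_mu), #|[set b in T i | x \in b]| = d.

End Trades.

(* Main.v *)
(** A Steiner triple system is the same as an operation [f], "the third point of
the block through [x] and [y]", which is idempotent, commutative and satisfies
[f x (f x y) = y]; two systems are disjoint iff their operations differ at all
[x <> y].  Three disjoint systems of order [v] are obtained as follows, with
[n = v %/ 3].

If [n] is odd, [v = 3n] and Bose's construction lives on [Z_n * Z_3]; if [n] is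
even, [v = 3n + 1] and Skolem's construction adds a point at infinity.  Both use
the blocks [(x, i), (y, i), (h (x + y), i + 1)], where [h] is a permutation of
[Z_n] with [2 h (s + 2 a) = 2 h s + 2 a]; they differ only in how the leftover
pairs [(x, i), (h (2 x), i + 1)] are covered.  Translating level [i] by [a i]
changes [2 h] on level [i] by [2 (a (i + 1) - a i)], so two translates are
disjoint as soon as these quantities differ on every level.  The translations
[a i = k i mod 3], for [k = 0, 1, 2], have increments differing by 1 or 2 up to
sign, which is enough unless [n] divides 4.  This leaves [v = 13], for
which a cyclic system, its negative and one more isomorphic copy work. *)
Require Import Defs.
From mathcomp Require Import all_boot all_algebra.
From mathcomp Require Import zify.
Set Implicit Arguments.
Unset Strict Implicit.
Unset Printing Implicit Defensive.
Import GRing.Theory.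

(** * Steiner quasigroups, their triple systems and the resulting trades *)

Definition steiner_quasigroup (V : Type) (f : V -> V -> V) : Prop :=
  [/\ forall x, f x x = x, forall x y, f x y = f y x
    & forall x y, f x (f x y) = y].

Definition disjoint_sts (V : Type) : Prop :=
  exists f : 'I_3 -> V -> V -> V, (forall k, steiner_quasigroup (f k)) /\
    (forall k l x y, k != l -> f k x y = f l x y -> x = y).

Section Blocks.

Variables (V : finType) (f : V -> V -> V).
Hypothesis f_sq : steiner_quasigroup f.

Definition block (x y : V) : {set V} := [set x; y; f x y].

Definition sts_blocks : {set {set V}} :=
  [set block p.1 p.2 | p : V * V & p.1 != p.2].

Lemma third_neq x y : x != y -> (f x y != x) && (f x y != y).
Proof.
case: f_sq => fid fC fK xy; apply/andP; split; apply: contraNneq xy => e.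
  by have := fK x y; rewrite e fid => ->.
by have := fK y x; rewrite (fC y x) e fid => ->.
Qed.

Lemma card_block x y : x != y -> #|block x y| = 3.
Proof.
move=> xy; have /andP[zx zy] := third_neq xy.
by rewrite /block setUC cardsU1 cards2 xy !inE negb_or zx zy.
Qed.

Lemma block_uniq b x y : b \in sts_blocks -> x \in b -> y \in b -> x != y ->
  b = block x y.
Proof.
case: f_sq => fid fC fK /imsetP[[u w]]; rewrite inE /= => uw -> {b}.
(* Nine positions of [x], [y] among [u], [w], [f u w]: equal positions contradict [x != y];
   otherwise [fC] and [fK] recover the remaining point. *)
rewrite !inE -!orbA => /or3P[] /eqP -> /or3P[] /eqP ->; rewrite ?eqxx // => _;
  apply/setP => z; rewrite /block !inE.
- by rewrite fK -!orbA; do 3 case: eqP.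
- by rewrite (fC w) -!orbA; do 3 case: eqP.
- by rewrite (fC u w) fK -!orbA; do 3 case: eqP.
- by rewrite (fC (f u w)) fK -!orbA; do 3 case: eqP.
- by rewrite (fC u w) (fC (f w u)) fK -!orbA; do 3 case: eqP.
Qed.

Lemma mem_sts_blocks x y : x != y -> block x y \in sts_blocks.
Proof. by move=> xy; apply/imsetP; exists (x, y); rewrite ?inE. Qed.

Lemma card_sts_block b : b \in sts_blocks -> #|b| = 3.
Proof. by case/imsetP=> -[x y]; rewrite inE /= => xy ->; apply: card_block. Qed.

Lemma blocks_through_pair x y : x != y ->
  blocks_through sts_blocks [set x; y] = [set block x y].
Proof.
move=> xy; apply/setP => b; rewrite !inE subUset !sub1set.
apply/idP/eqP => [/and3P[bB xb yb]|->]; first exact: block_uniq.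
by rewrite mem_sts_blocks // !inE !eqxx orbT.
Qed.

(** Double counting of pairs of a block through [x] and another point [y] of it: each block has two
    such points, each [y] lies in one such block. *)
Lemma sts_degree x : #|[set b in sts_blocks | x \in b]|.*2 = #|V|.-1.
Proof.
transitivity (\sum_(b in [set b in sts_blocks | x \in b]) #|b :\ x|).
  rewrite -muln2 -sum_nat_const; apply: eq_bigr => b; rewrite inE => /andP[bB xb].
  by have := cardsD1 x b; rewrite xb card_sts_block // => -[].
rewrite -cardsT (cardsD1 x [set: V]) inE /= -sum1_card.
under eq_bigr => b _ do rewrite -sum1_card.
rewrite (exchange_big_dep (mem ([set: V] :\ x))) /=; last first.
  by move=> b y _; rewrite !inE => /andP[->].
apply: eq_bigr => y; rewrite !inE andbT => yx.
transitivity #|blocks_through sts_blocks [set x; y]|.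
  rewrite -sum1_card; apply: eq_bigl => b.
  by rewrite !inE subUset !sub1set yx -andbA.
by rewrite blocks_through_pair ?cards1 // eq_sym.
Qed.

(** Counts incidences of points and blocks, each with weight 2 so that [sts_degree] applies. *)
Lemma card_sts_blocks : #|sts_blocks| * 6 = #|V| * #|V|.-1.
Proof.
rewrite -[6]/(3 * 2) mulnA -sum_nat_const -sum_nat_const big_distrl /=.
under eq_bigr => b bB do rewrite -(card_sts_block bB) -sum1_card big_distrl /=.
rewrite (exchange_big_dep predT) //=; apply: eq_bigr => x _.
rewrite -(sts_degree x) -muln2 -sum1_card big_distrl /=.
by apply: eq_bigl => b; rewrite inE.
Qed.

End Blocks.

Lemma disjoint_sts_trade (V : finType) : 3 < #|V| -> disjoint_sts V ->
  exists T : 'I_3 -> {set {set V}},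
    is_steiner_trade 3 2 (#|V| * (#|V| - 1) %/ 6) T /\
    homogeneous ((#|V| - 1) %/ 2) T.
Proof.
move=> V3 [f [fS fD]]; exists (fun k => sts_blocks (f k)).
have thr k (S : {set V}) : #|S| = 2 -> #|blocks_through (sts_blocks (f k)) S| = 1.
  move=> /eqP/cards2P[x [y [xy ->]]].
  by rewrite (blocks_through_pair (fS k)) ?cards1.
split; [split; first split|].
- by [].
- move=> i j ij; rewrite disjoint_subset; apply/subsetP => b bi; rewrite !inE.
  case/imsetP: (bi) => -[x y]; rewrite inE /= => xy eb; apply/negP => bj.
  have xb : x \in b by rewrite eb !inE eqxx.
  have yb : y \in b by rewrite eb !inE eqxx orbT.
  (* The third point of a common block is both [f i x y] and [f j x y]. *)
  have := block_uniq (fS j) bj xb yb xy; rewrite eb => /setP/(_ (f i x y)).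
  have /andP[/negbTE zx /negbTE zy] := third_neq (fS i) xy.
  rewrite !inE eqxx zx zy /= => /esym/eqP e.
  by move: xy; rewrite (fD _ _ _ _ ij e) eqxx.
- by move=> i; rewrite subn1 -(card_sts_blocks (fS i)) mulnK.
- by move=> i b; apply: (card_sts_block (fS i)).
- by move=> S S2 i j; rewrite !thr.
- by move=> S _ S2 i; rewrite thr.
- by move=> x i; rewrite subn1 -(sts_degree (fS i) x) -muln2 mulnK.
Qed.

Lemma disjoint_sts_card (V W : finType) : #|W| = #|V| ->
  disjoint_sts W -> disjoint_sts V.
Proof.
move=> eWV [f [fS fD]].
pose a (x : V) : W := enum_val (cast_ord (esym eWV) (enum_rank x)).
pose b (x : W) : V := enum_val (cast_ord eWV (enum_rank x)).
have aK : cancel a b by move=> x; rewrite /a /b enum_valK cast_ordKV enum_rankK.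
have bK : cancel b a by move=> x; rewrite /a /b enum_valK cast_ordK enum_rankK.
exists (fun k x y => b (f k (a x) (a y))); split=> [k|k l x y kl e].
  case: (fS k) => fid fC fK; split=> [x|x y|x y]; rewrite ?bK ?fK ?fid ?aK //.
  by rewrite fC.
by apply: (can_inj aK); apply: fD kl _; apply: (can_inj bK).
Qed.

(** * Order 13 *)

(* The system with base blocks {0, 1, 4} and {0, 2, 7} modulo 13: the list gives
   the third point of the block through 0 and each other point. *)
Definition cyclic13 (x y : nat) : nat :=
  (x + nth 0 [:: 0; 4; 7; 12; 1; 11; 8; 2; 6; 10; 9; 5; 3] ((y + (13 - x)) %% 13)) %% 13.

(* The identity, negation and (3 4)(5 7)(8 9)(10 12); all three are involutions,
   as the conjugation in third13 requires. The last one was found by search. *)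
Definition perm13 (k x : nat) : nat :=
  nth 0 (nth [::] [:: iota 0 13; 0 :: rev (iota 1 12);
                      [:: 0; 1; 2; 4; 3; 7; 6; 5; 9; 8; 12; 11; 10]] k) x.

Definition third13 (k x y : nat) : nat :=
  perm13 k (cyclic13 (perm13 k x) (perm13 k y)).

Lemma third13_check : all (fun k => all (fun x => all (fun y =>
    [&& third13 k x y < 13, third13 k x x == x, third13 k x y == third13 k y x,
        third13 k x (third13 k x y) == y
      & all (fun l => (l != k) ==> (third13 k x y == third13 l x y) ==> (x == y))
          (iota 0 3)])
  (iota 0 13)) (iota 0 13)) (iota 0 3).
Proof. by vm_compute. Qed.

Lemma disjoint_sts13 : disjoint_sts 'I_13.
Proof.
have chk (k : 'I_3) (x y : 'I_13) :
    [&& third13 k x y < 13, third13 k x x == x, third13 k x y == third13 k y x,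
        third13 k x (third13 k x y) == y
      & all (fun l : nat => (l != k :> nat) ==> (third13 k x y == third13 l x y) ==>
            (x == y :> nat))
          (iota 0 3)].
  by apply: (allP (allP (allP third13_check k _) x _) y _); rewrite mem_iota /=.
have lt13 k x y : third13 (k : 'I_3) (x : 'I_13) (y : 'I_13) < 13.
  by case/and5P: (chk k x y).
exists (fun k x y => Ordinal (lt13 k x y)); split=> [k|k l x y kl [e]].
  by split=> [x|x y|x y]; apply: val_inj => /=;
    [case/and5P: (chk k x x)|case/and5P: (chk k x y)|case/and5P: (chk k x y)]
    => _ /eqP e1 /eqP e2 /eqP e3 _.
case/and5P: (chk k x y) => _ _ _ _ /allP/(_ l); rewrite mem_iota ltn_ord e eqxx.
have -> : (l != k :> nat) by rewrite eq_sym.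
by move=> /(_ isT)/eqP/val_inj.
Qed.

(** * The constructions of Bose and Skolem *)

Lemma ordS3K (i : 'I_3) : ordS (ordS (ordS i)) = i.
Proof. by apply: val_inj; case: i => [[|[|[|]]]]. Qed.

Lemma ordS3_neq (i : 'I_3) : (ordS i == i) = false.
Proof. by case: i => [[|[|[|]]]]. Qed.

Lemma ordS3_total (i j : 'I_3) : [\/ j = i, j = ordS i | i = ordS j].
Proof.
by case: i j => [[|[|[|//]]] ?] [[|[|[|//]]] ?];
  (apply: Or31 + apply: Or32 + apply: Or33); apply: val_inj.
Qed.

Lemma ordSS3_neq (i : 'I_3) :
  ((i == ordS i) = false) * ((ordS (ordS i) == i) = false) *
  ((i == ordS (ordS i)) = false).
Proof. by case: i => [[|[|[|]]]]. Qed.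

Section BoseSkolem.

Local Open Scope ring_scope.

Variables (Q : zmodType) (h h' : Q -> Q).
Hypotheses (hK : cancel h h') (h'K : cancel h' h) (h0 : h 0 = 0).
Hypothesis h_double : forall s a, h (s + (a + a)) + h (s + (a + a)) = h s + h s + (a + a).

(** The blocks with two points on level [i] join [(x, i)] to [(z, ordS i)] through [(h' z - x, i)],
    which must differ from [(x, i)]; this fails exactly at [z = diag x], the leftover pair. *)
Let diag (x : Q) : Q := h (x + x).

Lemma diag_double x : diag x + diag x = x + x.
Proof. by rewrite /diag -[x + x in LHS]add0r h_double h0 !add0r. Qed.

Lemma diagK x : diag (diag x) = diag x.
Proof. by rewrite {1}/diag diag_double. Qed.

(* [None] is the point at infinity. In Bose's case [diag] is the identity and
   [None] does not occur. *)
Definition up (i : 'I_3) (x y : Q) : option (Q * 'I_3) :=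
  if y == diag x then if diag x == x then Some (x, ordS (ordS i)) else None
  else Some (h' y - x, i).

Definition third (p q : Q * 'I_3) : option (Q * 'I_3) :=
  if p == q then Some p else
  if q.2 == p.2 then Some (h (p.1 + q.1), ordS p.2) else
  if q.2 == ordS p.2 then up p.2 p.1 q.1 else up q.2 q.1 p.1.

Lemma third_level i x y : x != y -> third (x, i) (y, i) = Some (h (x + y), ordS i).
Proof. by move=> /negbTE xy; rewrite /third xpair_eqE xy eqxx. Qed.

Lemma third_up i x y : third (x, i) (y, ordS i) = up i x y.
Proof. by rewrite /third xpair_eqE /= ordS3_neq ordSS3_neq andbF eqxx. Qed.

Lemma third_down i x y : third (x, ordS i) (y, i) = up i y x.
Proof. by rewrite /third xpair_eqE /= ordS3_neq !ordSS3_neq andbF. Qed.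

Lemma third_down2 i x y : third (x, i) (y, ordS (ordS i)) = up (ordS (ordS i)) y x.
Proof. by rewrite -{1}[i]ordS3K third_down. Qed.

Lemma third_id p : third p p = Some p.
Proof. by rewrite /third eqxx. Qed.

Lemma thirdC p q : third p q = third q p.
Proof.
case: p q => [x i] [y j]; case: (ordS3_total i j) => ->; last 2 first.
- by rewrite third_up third_down.
- by rewrite third_up third_down.
by have [->//|xy] := eqVneq x y; rewrite !third_level ?(eq_sym y) // addrC.
Qed.

Lemma thirdK p q r : third p q = Some r -> third p r = Some q.
Proof.
case: p q => [x i] [y j]; case: (ordS3_total i j) => ->.
- have [->|xy] := eqVneq x y; first by rewrite third_id => -[<-]; rewrite third_id.
  rewrite third_level // => -[<-]; rewrite third_up /up (can_eq hK).
  by rewrite (inj_eq (addrI x)) eq_sym (negbTE xy) hK addrC addKr.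
- rewrite third_up /up; case: eqP => [->|/eqP yx].
    case: eqP => // e [<-]; rewrite e third_down2.
    by rewrite /up e eqxx ordS3K.
  move=> [<-]; rewrite third_level; first by rewrite addrC subrK h'K.
  by apply: contraNneq yx => e; rewrite /diag {2}e [x + _]addrC subrK h'K.
- rewrite third_down /up; case: eqP => [->|/eqP yx].
    case: eqP => // e [<-]; rewrite e third_up.
    by rewrite /up e eqxx ordS3K.
  move=> [<-]; rewrite third_down /up; case: eqP => [e|_].
    (* Here [h' x] is both [z + z] and [z + y], so [z = y] and the pair would be a leftover one. *)
    case/negP: yx; move: e; set z := _ - y => e.
    have : h' x = z + z by rewrite {1}e /diag hK.
    by rewrite -[h' x](subrK y) -/z => /addrI ey; rewrite {1}e ey.
  by rewrite opprB addrC subrK.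
Qed.

(** * Translates of the construction and their disjointness *)

Definition shift (a : 'I_3 -> Q) (p : Q * 'I_3) : Q * 'I_3 := (p.1 + a p.2, p.2).
Definition unshift (a : 'I_3 -> Q) (p : Q * 'I_3) : Q * 'I_3 := (p.1 - a p.2, p.2).

Lemma shiftK a : cancel (shift a) (unshift a).
Proof. by case=> x i; rewrite /shift /unshift addrK. Qed.

Lemma unshiftK a : cancel (unshift a) (shift a).
Proof. by case=> x i; rewrite /shift /unshift subrK. Qed.

Definition shifted_third a p q := omap (shift a) (third (unshift a p) (unshift a q)).

Lemma shifted_thirdC a p q : shifted_third a p q = shifted_third a q p.
Proof. by rewrite /shifted_third thirdC. Qed.

Lemma shifted_third_disjoint a b :
    (forall i, (a (ordS i) - a i) + (a (ordS i) - a i) !=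
               (b (ordS i) - b i) + (b (ordS i) - b i)) ->
  forall p q, shifted_third a p q = shifted_third b p q -> p = q.
Proof.
move=> ab.
(* Doubling both sides leaves, by [h_double], [h (x + y)] twice plus the doubled increment of the
   translation, where [ab] separates them. *)
have key i x y : h ((x - a i) + (y - a i)) + a (ordS i) <>
                 h ((x - b i) + (y - b i)) + b (ordS i).
  move=> /(congr1 (fun z => z + z)) e; case/eqP: (ab i); move: e.
  have D c : h (x - c i + (y - c i)) + c (ordS i) + (h (x - c i + (y - c i)) + c (ordS i))
     = h (x + y) + h (x + y) + (c (ordS i) - c i + (c (ordS i) - c i)).
    rewrite addrACA [x - _ + _]addrACA h_double -addrA; congr (_ + _).
    by rewrite [RHS]addrACA addrC.
  by rewrite !D => /addrI.
(* Two leftover pairs contradict [key i x x]. If just one is leftover, its third point is infinity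
   or on level [i + 2], the other on level [i]. Otherwise a common third point on level [i]
   contradicts [key] for it and [x]. *)
have up_disj i x y : shifted_third a (x, i) (y, ordS i) <>
                     shifted_third b (x, i) (y, ordS i).
  rewrite /shifted_third /unshift /= !third_up /up.
  have diagE c : (y - c (ordS i) == diag (x - c i)) =
                 (y == h ((x - c i) + (x - c i)) + c (ordS i)) by rewrite subr_eq.
  rewrite !diagE; case: (y =P _) => [ya|_]; case: (y =P _) => [yb|_].
  - by case: (key i x x); rewrite -ya -yb.
  - by case: ifP => //= _ [] _ /eqP; rewrite ordSS3_neq.
  - by case: ifP => //= _ [] _ /esym/eqP; rewrite ordSS3_neq.
  rewrite /shift /= => -[e].
  have E c : h (h' (y - c (ordS i)) - (x - c i) + c i - c i + (x - c i)) + c (ordS i) = y.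
    by rewrite addrK subrK h'K subrK.
  by apply: (key i (h' (y - a (ordS i)) - (x - a i) + a i) x); rewrite {2}e !E.
move=> [x i] [y j]; case: (ordS3_total i j) => -> e.
- apply/eqP; rewrite xpair_eqE eqxx andbT; apply: contraPT e => xy.
  rewrite /shifted_third /unshift /= !third_level ?(inj_eq (addIr _)) //.
  by rewrite /shift /= => -[]; apply: key.
- by case: (up_disj _ _ _ e).
- by case: (up_disj j y x); rewrite shifted_thirdC e shifted_thirdC.
Qed.

Lemma shifted_third_id a p : shifted_third a p p = Some p.
Proof. by rewrite /shifted_third third_id /= unshiftK. Qed.

Lemma shifted_thirdK a p q r :
  shifted_third a p q = Some r -> shifted_third a p r = Some q.
Proof.
rewrite /shifted_third; case e: (third _ _) => [s|] //= [<-].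
by rewrite shiftK (thirdK e) /= unshiftK.
Qed.

Variable a : 'I_3 -> 'I_3 -> Q.
Hypothesis a_disjoint : forall k l, k != l -> forall i,
  (a k (ordS i) - a k i) + (a k (ordS i) - a k i) !=
  (a l (ordS i) - a l i) + (a l (ordS i) - a l i).

Lemma bose : (forall x : Q, x + x = 0 -> x = 0) -> disjoint_sts (Q * 'I_3)%type.
Proof.
move=> tors; have diagE x : diag x = x.
  apply/eqP; rewrite -subr_eq0; apply/eqP/tors.
  by rewrite addrACA diag_double -opprD subrr.
(* As [diag] is the identity, infinity never occurs and the default of [odflt] is never reached. *)
have some c p q : shifted_third c p q = Some (odflt p (shifted_third c p q)).
  rewrite /shifted_third; set u := unshift c p; set w := unshift c q.
  suff : third u w by case: third.
  case: u w => [x i] [y j]; case: (ordS3_total i j) => ->.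
  - by have [->|xy] := eqVneq x y; rewrite ?third_id // third_level.
  - by rewrite third_up /up diagE eqxx; case: ifP.
  - by rewrite third_down /up diagE eqxx; case: ifP.
exists (fun k p q => odflt p (shifted_third (a k) p q)); split=> [k|k l p q kl e].
  split=> [p|p q|p q]; first by rewrite shifted_third_id.
    by apply/Some_inj; rewrite -!some shifted_thirdC.
  by apply/Some_inj; rewrite -!some; apply: shifted_thirdK; apply: some.
by apply: (shifted_third_disjoint (a_disjoint kl)); rewrite some e -some.
Qed.

(** * Skolem's case: completing with the point at infinity *)

Variable t : Q.
Hypotheses (t_neq0 : t != 0) (tt : t + t = 0).
Hypothesis torsion : forall x : Q, x + x = 0 -> x = 0 \/ x = t.

(* The pairs completed by the point at infinity are [x], [diag x] on consecutive
   levels with [diag x != x]; since [diag x] is [x] or [x + t], each point lies in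
   exactly one of them. *)
Definition partner (p : Q * 'I_3) : Q * 'I_3 :=
  (p.1 + t, if diag p.1 == p.1 then ordS (ordS p.2) else ordS p.2).

Lemma addtK x : x + t + t = x.
Proof. by rewrite -addrA tt addr0. Qed.

Lemma diag_addt x : diag (x + t) = diag x.
Proof. by rewrite /diag addrACA tt addr0. Qed.

Lemma addt_neq x : (x + t == x) = false.
Proof. by rewrite -subr_eq0 addrC addKr (negbTE t_neq0). Qed.

Lemma diagP x : diag x = x \/ diag x = x + t.
Proof.
have [|e|e] := @torsion (diag x - x).
- by rewrite addrACA diag_double -opprD subrr.
- by left; apply/eqP; rewrite -subr_eq0 e.
- by right; rewrite -e addrC subrK.
Qed.

Lemma partnerK : involutive partner.
Proof.
case=> x i; rewrite /partner /= diag_addt addtK.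
by case: (diagP x) => ->; rewrite eqxx ?addt_neq ?[x == _]eq_sym ?addt_neq ordS3K.
Qed.

Lemma third_partner p : third p (partner p) = None.
Proof.
case: p => x i; rewrite /partner /=; case: ifP => [/eqP e|e].
  by rewrite third_down2 /up diag_addt e eqxx eq_sym addt_neq.
by rewrite third_up /up e; case: (diagP x) e => ->; rewrite eqxx.
Qed.

Lemma third_None p q : third p q = None -> q = partner p.
Proof.
case: p q => [x i] [y j]; rewrite /partner; case: (ordS3_total i j) => -> /=.
- by have [->|xy] := eqVneq x y; rewrite ?third_id // third_level.
- rewrite third_up /up; case: eqP => [->|//]; case: ifP => // e _.
  by case: (diagP x) e => ->; rewrite ?eqxx.
- rewrite third_down /up; case: eqP => [->|//]; case: ifP => // e _.
  by rewrite diagK eqxx ordS3K; case: (diagP y) e => ->; rewrite ?eqxx // addtK.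
Qed.

Definition shifted_partner c p := shift c (partner (unshift c p)).

Definition skolem_third (c : 'I_3 -> Q) (p q : option (Q * 'I_3)) : option (Q * 'I_3) :=
  match p, q with
  | Some p, Some q => shifted_third c p q
  | Some p, None | None, Some p => Some (shifted_partner c p)
  | None, None => None
  end.

Lemma shifted_partnerK c : involutive (shifted_partner c).
Proof. by move=> p; rewrite /shifted_partner shiftK partnerK unshiftK. Qed.

Lemma shifted_third_partner c p : shifted_third c p (shifted_partner c p) = None.
Proof. by rewrite /shifted_third shiftK third_partner. Qed.

Lemma shifted_third_None c p q :
  shifted_third c p q = None -> q = shifted_partner c p.
Proof.
rewrite /shifted_third /shifted_partner; case e: third => // _.
by rewrite -(third_None e) unshiftK.
Qed.

Lemma skolem_third_sq c : steiner_quasigroup (skolem_third c).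
Proof.
split.
- by case=> //= p; rewrite shifted_third_id.
- by case=> [p|] [q|] //=; apply: shifted_thirdC.
case=> [p|] [q|] //=; last 2 first.
- by rewrite shifted_third_partner.
- by rewrite shifted_partnerK.
case e: shifted_third => [r|]; first exact: shifted_thirdK.
by rewrite (shifted_third_None e).
Qed.

Lemma skolem : disjoint_sts (option (Q * 'I_3)%type).
Proof.
exists (fun k => skolem_third (a k)); split=> [k|k l]; first exact: skolem_third_sq.
(* A common partner would give the value [None] in both translates, so by disjointness [p] would be
   its own partner, against idempotence. *)
have partner_disj p : k != l -> shifted_partner (a k) p <> shifted_partner (a l) p.
  move=> kl e; have pE : p = shifted_partner (a k) p.
    apply: (shifted_third_disjoint (a_disjoint kl)).
    by rewrite shifted_third_partner e shifted_third_partner.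
  by have := shifted_third_partner (a k) p; rewrite -pE shifted_third_id.
case=> [p|] [q|] kl //=; last 2 first.
- by move=> /Some_inj/(partner_disj _ kl).
- by move=> /Some_inj/(partner_disj _ kl).
by move/(shifted_third_disjoint (a_disjoint kl)) ->.
Qed.

End BoseSkolem.

(** * Halving modulo n *)

Section Halving.

Variable m : nat.
Local Notation n := m.+2.

(* Division by 2 for odd [n]; for even [n], half of the residues [2j] and [2j+1]
   are [j] and [j + n/2]. *)
Definition halve (s : 'I_n) : 'I_n := inord (s./2 + (if odd s then uphalf n else 0)).

Definition unhalve (z : 'I_n) : 'I_n :=
  inord (if z < uphalf n then z.*2 else (z - uphalf n).*2.+1).

Lemma val_halve s : halve s = s./2 + (if odd s then uphalf n else 0) :> nat.
Proof. by rewrite inordK //; have := ltn_ord s; case: ifP; lia. Qed.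

Lemma val_unhalve z :
  unhalve z = (if z < uphalf n then z.*2 else (z - uphalf n).*2.+1) :> nat.
Proof. by rewrite inordK //; have := ltn_ord z; case: ifP; lia. Qed.

Lemma halveK : cancel halve unhalve.
Proof.
move=> s; apply: val_inj; rewrite /= val_unhalve val_halve.
have lt_s := ltn_ord s.
by case: (boolP (odd s)) => ?; case: ltnP; lia.
Qed.

Lemma unhalveK : cancel unhalve halve.
Proof.
move=> z; apply: val_inj; rewrite /= val_halve val_unhalve.
have lt_z := ltn_ord z.
by case: ltnP; case: ifP; lia.
Qed.

Local Open Scope ring_scope.

Lemma halve0 : halve 0 = 0.
Proof. by apply: val_inj; rewrite /= val_halve. Qed.

Lemma halve_add s : halve s + halve s + inord (odd s && ~~ odd n) = s.
Proof.
apply: val_inj; rewrite /= modnDml inordK; last by case: (_ && _).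
rewrite val_halve -[in RHS](modn_small (ltn_ord s)).
(* The sum wraps around exactly once when [s] is odd, for either parity of [n]. *)
have [k ->] : exists k, (s./2 + (if odd s then uphalf n else 0) +
    (s./2 + (if odd s then uphalf n else 0))
    + (odd s && ~~ odd n) = k * n + s)%N.
  by exists (odd s : nat); case: ifP; lia.
by rewrite modnMDl.
Qed.

Lemma halve_double s a :
  halve (s + (a + a)) + halve (s + (a + a)) = halve s + halve s + (a + a).
Proof.
(* For even [n], adding [a + a] preserves parity, so both sides have the same rounding error in
   [halve_add]. *)
have par : odd (s + (a + a))%R && ~~ odd n = odd s && ~~ odd n.
  case: (boolP (odd n)) => nn; rewrite ?andbF // !andbT /=.
  by rewrite !odd_mod ?(negbTE nn) // oddD odd_mod ?(negbTE nn) // addnn odd_double addbF.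
apply: (addIr (inord (odd s && ~~ odd n))).
by rewrite -{1}par halve_add addrAC halve_add.
Qed.

Lemma double_eq0 (x : 'I_n) : x + x = 0 -> x = 0 \/ (~~ odd n /\ x = inord n./2).
Proof.
move=> /(congr1 val) /= /eqP; rewrite -/(dvdn _ _) => /dvdnP[[|[|k]] e].
- by left; apply: val_inj => /=; lia.
- by right; split; [lia|apply: val_inj; rewrite /= inordK; lia].
- by have := ltn_ord x; lia.
Qed.

(** Removes subtractions, so that offsets can be compared as natural numbers modulo [n]. *)
Lemma double_sub_eq (G : zmodType) (x y z w : G) :
  ((x - y) + (x - y) == (z - w) + (z - w)) = (z + z + (y + y) == x + x + (w + w)).
Proof.
have E (a b : G) : (a - b) + (a - b) = (a + a) - (b + b) by rewrite addrACA opprD.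
by rewrite !E subr_eq addrAC eq_sym subr_eq.
Qed.

Definition offset (k i : 'I_3) : 'I_n := ((k * i) %% 3)%:R.

Lemma offset_disjoint k l : (2 < n)%N -> n != 4 -> k != l -> forall i,
  (offset k (ordS i) - offset k i) + (offset k (ordS i) - offset k i) !=
  (offset l (ordS i) - offset l i) + (offset l (ordS i) - offset l i).
Proof.
move=> n2 n4 kl i; rewrite double_sub_eq.
rewrite -!natrD -val_eqE /= !Zp_nat /=.
(* With truncated subtraction, [p - q + (q - p)] is the distance of [p] and [q]; [n] divides neither
   2 nor 4. *)
have far p q : (p - q + (q - p) \in [:: 2; 4])%N -> (p %% n != q %% n)%N.
  wlog pq : p q / (p <= q)%N.
    by case: (leqP p q) => [/[swap]|/ltnW /[swap] H qp]; [exact|rewrite addnC eq_sym; apply: H].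
  have /eqP-> : (p - q == 0)%N by rewrite subn_eq0.
  rewrite add0n eq_sym eqn_mod_dvd // !inE => /orP[] /eqP ->.
    by apply/negP => /dvdn_leq; lia.
  by apply/negP => d; have := @dvdn_leq n 4 isT d; case: m n2 n4 d => [|[|[|]]].
apply: far.
by move: k l i kl => [[|[|[|//]]] ?] [[|[|[|//]]] ?] [[|[|[|//]]] ?].
Qed.

End Halving.

(** * Choice of the construction from [v] modulo 6 *)

Theorem theorem1p9 (v : nat)
    (v_mod6 : v = 1 %[mod 6] \/ v = 3 %[mod 6]) (v_neq7 : v <> 7) (v_gt3 : 3 < v)
    (V : finType) (card_V : #|V| = v) :
  exists T : 'I_3 -> {set {set V}},
    is_steiner_trade 3 2 (v * (v - 1) %/ 6) T /\
    homogeneous ((v - 1) %/ 2) T.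
Proof.
rewrite -card_V; apply: disjoint_sts_trade; first by rewrite card_V.
have [v13|v_neq13] := eqVneq v 13.
  by apply: disjoint_sts_card disjoint_sts13; rewrite card_ord card_V.
have [m em] : exists m, v %/ 3 = m.+2 by exists (v %/ 3 - 2); lia.
(* The value [n = 2] would mean [v = 7], and [n = 4] would mean [v = 13]. *)
have n2 : 2 < m.+2 by lia.
have n4 : m.+2 != 4 by lia.
have off k l kl := offset_disjoint (k := k) (l := l) n2 n4 kl.
have hD := @halve_double m.
case: v_mod6 => v_mod.
  (* For even [n], [n / 2] is the only element of order two. *)
  pose t : 'I_m.+2 := inord (m.+2)./2.
  have vt : t = (m.+2)./2 :> nat by rewrite inordK //; lia.
  apply: disjoint_sts_card (skolem (@halveK m) (@unhalveK m) (halve0 m) hD off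
    (t := t) _ _ _).
  - by rewrite card_option card_prod !card_ord; lia.
  - by rewrite -val_eqE /= vt; lia.
  - apply: val_inj => /=; rewrite vt addnn.
    have -> : (m.+2)./2.*2 = m.+2 by lia.
    by rewrite modnn.
  - by move=> x /double_eq0[->|[_ ->]]; [left|right].
apply: disjoint_sts_card (bose (@halveK m) (@unhalveK m) (halve0 m) hD off _).
  by rewrite card_prod !card_ord; lia.
by move=> x /double_eq0[//|[]]; lia.
Qed.
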